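(* For a finite group $G$, the following are equivalent. (a) $\mathcal{E}(G)$ is a cograph; (b) for all pairwise distinct maximal cyclic subgroups $A,B,C$ of $G$, either $A\cap B\leq A\cap C$ or $A\cap C\leq A\cap B$.
   Context: The enhanced power graph $\mathcal{E}(G)$ of a group $G$ is the (simple, undirected) graph with vertex set $G$ in which $\{x,y\}$ is an edge if and only if $x\neq y$ and $\langle x,y\rangle$ is cyclic. A cograph is a graph with no induced subgraph isomorphic to the path $P_4$ with four vertices. A maximal cyclic subgroup of $G$ is a cyclic subgroup not properly contained in another cyclic subgroup of $G$. *)

(* Defs.v *)
From mathcomp Require Import all_boot all_fingroup all_solvable.

Set Implicit Arguments.
Unset Strict Implicit.
Unset Printing Implicit Defensive.

Import GroupScope.

Record sgraph := SGraph {
  vertex :> finType;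
  adj : rel vertex;
  adj_sym : symmetric adj;
  adj_irrefl : irreflexive adj
}.

(* An injection preserving and reflecting adjacency identifies K with the
   subgraph of H induced on its image. *)
Definition has_induced (H K : sgraph) : Prop :=
  exists2 f : K -> H, injective f & forall i j : K, adj (f i) (f j) = adj i j.

Definition path_adj (n : nat) : rel 'I_n :=
  fun i j => (i.+1 == j :> nat) || (j.+1 == i :> nat).

Lemma path_adj_sym n : symmetric (@path_adj n).
Proof. by move=> i j; rewrite /path_adj orbC. Qed.

Lemma path_adj_irrefl n : irreflexive (@path_adj n).
Proof. by move=> i; rewrite /path_adj orbb gtn_eqF. Qed.

Definition path_graph (n : nat) : sgraph :=
  SGraph (@path_adj_sym n) (@path_adj_irrefl n).

Definition cograph (H : sgraph) : Prop := ~ has_induced H (path_graph 4).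

Section EnhancedPowerGraph.

Variables (gT : finGroupType) (G : {group gT}).

Definition epg_adj : rel [subg G] :=
  fun x y => (x != y) && cyclic <<[set sgval x; sgval y]>>.

Lemma epg_adj_sym : symmetric epg_adj.
Proof. by move=> x y; rewrite /epg_adj eq_sym setUC. Qed.

Lemma epg_adj_irrefl : irreflexive epg_adj.
Proof. by move=> x; rewrite /epg_adj eqxx. Qed.

Definition enhanced_power_graph : sgraph := SGraph epg_adj_sym epg_adj_irrefl.

Definition max_cyclic (A : {group gT}) : bool :=
  [max A | (A \subset G) && cyclic A].

End EnhancedPowerGraph.

(* Main.v *)
Require Import Defs.
From mathcomp Require Import all_boot all_fingroup all_solvable.

(** Two elements of [G] generate a cyclic group exactly when they lie in a
    common maximal cyclic subgroup. If [a - b - c - d] is an induced path, choose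
    maximal cyclic subgroups [B], [A], [C] through its edges [ab], [bc], [cd].
    Then [b] lies in [A :&: B] but not in [C], as it would otherwise be joined
    to [d], and [c] lies in [A :&: C] but not in [B]: the two intersections are
    incomparable. Conversely, if [b] is in [A :&: B] but not in [C] and [c] is in
    [A :&: C] but not in [B], then generators [a] of [B] and [d] of [C] complete
    the induced path [a - b - c - d], because an element that generates a cyclic
    group together with a generator of a maximal cyclic subgroup belongs to that
    subgroup ([mem_max_cyclic]).

    All of this is about the relation of generating a cyclic group, which is
    the reflexive closure of adjacency; [induced_P4P] shows that induced paths
    on four vertices can be read off this relation. *)

Set Implicit Arguments.
Unset Strict Implicit.
Unset Printing Implicit Defensive.

Import GroupScope.

(** Distinctness of the four vertices is forced by the pattern: any two of
    them are told apart by some vertex related to exactly one of the two. *)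
Lemma induced_P4P (H : sgraph) (e : rel H) :
    (forall x y, adj x y = (x != y) && e x y) ->
    reflexive e -> symmetric e ->
  has_induced H (path_graph 4) <->
  exists a b c d : H,
    [/\ e a b, e b c & e c d] /\ [/\ ~~ e a c, ~~ e b d & ~~ e a d].
Proof.
move=> adjE e_refl e_sym; split.
  case=> f f_inj f_adj; pose i k : path_graph 4 := @inord 3 k.
  have i_neq j k : j < 4 -> k < 4 -> j != k -> f (i j) != f (i k).
    move=> lt_j lt_k neq_jk; rewrite (inj_eq f_inj).
    by rewrite -(inj_eq val_inj) /= !inordK.
  have eE j k : j < 4 -> k < 4 -> j != k ->
      e (f (i j)) (f (i k)) = (j.+1 == k) || (k.+1 == j).
    move=> lt_j lt_k neq_jk; have := f_adj (i j) (i k).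
    by rewrite adjE i_neq //= /path_adj /= !inordK.
  by exists (f (i 0)), (f (i 1%N)), (f (i 2)), (f (i 3)); rewrite !eE.
case=> a [b [c [d [[ab bc cd] [/negbTE ac /negbTE bd /negbTE ad]]]]].
(* The third vertex named in each use below is the one that separates. *)
have neq x y z : e x z -> e y z = false -> (x == y) = false.
  by move=> xz yz; apply: contraTF xz => /eqP->; rewrite yz.
have ab' : (a == b) = false by rewrite eq_sym (neq b a c).
have bc' : (b == c) = false by rewrite eq_sym (neq c b d).
have cd' : (c == d) = false by rewrite (neq c d b) // e_sym.
have ac' : (a == c) = false by rewrite eq_sym (neq c a d).
have bd' : (b == d) = false by rewrite (neq b d a) // e_sym.
have ad' : (a == d) = false by rewrite (neq a d b) // e_sym.
exists (fun i : path_graph 4 => nth a [:: a; b; c; d] i).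
  have Us : uniq [:: a; b; c; d].
    by rewrite /= !inE ab' ac' ad' bc' bd' cd'.
  move=> i j /eqP; rewrite nth_uniq //= => /eqP; exact: val_inj.
pose E := (ab', bc', cd', ac', bd', ad', ab, bc, cd, ac, bd, ad, eqxx).
case=> [[|[|[|[|?]]]] //= lt_i] [[|[|[|[|?]]]] //= lt_j];
  first [by rewrite adjE !E | by rewrite adj_sym adjE !E].
Qed.

Section MaximalCyclic.

Variables (gT : finGroupType) (G : {group gT}).
Implicit Types (M N : {group gT}) (x y : gT).

Lemma max_cyclicP M :
  reflect [/\ M \subset G, cyclic M &
             forall N, N \subset G -> cyclic N -> M \subset N -> N :=: M]
          (max_cyclic G M).
Proof.
apply: (iffP maxgroupP) => [[/andP[sMG cM] maxM] | [sMG cM maxM]]; split=> //.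
- by move=> N sNG cN; apply: maxM; rewrite sNG.
- by rewrite sMG.
by move=> N /andP[sNG cN]; apply: maxM.
Qed.

Lemma cyclic_pair M x y :
  cyclic M -> x \in M -> y \in M -> cyclic <<[set x; y]>>.
Proof.
move=> cM Mx My; apply: cyclicS cM.
by rewrite gen_subG subUset !sub1set Mx.
Qed.

Lemma cyclic_pair_max x y : x \in G -> y \in G -> cyclic <<[set x; y]>> ->
  exists2 M, max_cyclic G M & (x \in M) && (y \in M).
Proof.
move=> Gx Gy cxy.
have sxyG : <<[set x; y]>> \subset G by rewrite gen_subG subUset !sub1set Gx.
have [|M maxM sM] :=
  @maxgroup_exists _ (fun A => (A \subset G) && cyclic A) <<[set x; y]>>%G.
  by rewrite sxyG.
by exists M => //; rewrite !(subsetP sM) // mem_gen // !inE eqxx ?orbT.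
Qed.

(** The cyclic group generated by [x] and [y] contains [M], and maximality of
    [M] leaves no room for it to be larger. *)
Lemma mem_max_cyclic M x y : max_cyclic G M -> M :=: <[x]> -> y \in G ->
  cyclic <<[set x; y]>> -> y \in M.
Proof.
case/max_cyclicP=> sMG _ maxM defM Gy cxy.
have Gx : x \in G by rewrite (subsetP sMG) // defM cycle_id.
rewrite -(maxM <<[set x; y]>>%G) ?mem_gen ?inE ?eqxx ?orbT //.
  by rewrite gen_subG subUset !sub1set Gx.
by rewrite defM cycle_subG mem_gen // !inE eqxx.
Qed.

Lemma max_cyclic_inj M N :
  max_cyclic G M -> max_cyclic G N -> M \subset N -> M = N.
Proof.
case/max_cyclicP=> _ _ maxM /max_cyclicP[sNG cN _] sMN.
by apply/group_inj; rewrite (maxM N).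
Qed.

End MaximalCyclic.

Theorem proposition4p3 (gT : finGroupType) (G : {group gT}) :
  cograph (enhanced_power_graph G) <->
  (forall A B C : {group gT},
     max_cyclic G A -> max_cyclic G B -> max_cyclic G C ->
     A <> B -> A <> C -> B <> C ->
     A :&: B \subset A :&: C \/ A :&: C \subset A :&: B).
Proof.
pose e : rel (enhanced_power_graph G) :=
  fun x y => cyclic <<[set sgval x; sgval y]>>.
have e_refl : reflexive e by move=> x; rewrite /e setUid cycle_cyclic.
have e_sym : symmetric e by move=> x y; rewrite /e setUC.
have adjE x y : adj x y = (x != y) && e x y by [].
have [P4_e e_P4] := induced_P4P adjE e_refl e_sym.
split=> [noP4 A B C maxA maxB maxC _ _ neqBC | chain].
  have [sAB | /subsetPn[b]] := boolP (A :&: B \subset A :&: C); first by left.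
  case/setIP=> Ab Bb; rewrite inE Ab /= => C'b; right.
  apply/subsetP=> c /setIP[Ac Cc]; rewrite inE Ac /=.
  apply/negPn/negP=> B'c; apply/noP4/e_P4.
  (* Generators [a] of [B] and [d] of [C] are the end points of the path. *)
  have [[sAG cA _] [sBG cB _] [sCG cC _]] :=
    And3 (max_cyclicP _ _ maxA) (max_cyclicP _ _ maxB) (max_cyclicP _ _ maxC).
  have [[a defB] [d defC]] := (cyclicP cB, cyclicP cC).
  have Ba : a \in B by rewrite defB cycle_id.
  have Cd : d \in C by rewrite defC cycle_id.
  have [Ga Gb] : a \in G /\ b \in G by rewrite !(subsetP sBG).
  have [Gc Gd] : c \in G /\ d \in G by rewrite !(subsetP sCG).
  exists (subg G a), (subg G b), (subg G c), (subg G d).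
  rewrite /e !subgK //; split; split.
  - exact: cyclic_pair Bb.
  - exact: cyclic_pair Ac.
  - exact: cyclic_pair Cd.
  - by apply: contra B'c; apply: mem_max_cyclic maxB defB Gc.
  - by apply: contra C'b; rewrite setUC; apply: mem_max_cyclic maxC defC Gb.
  apply/negP=> /(mem_max_cyclic maxB defB Gd) Bd; apply: neqBC.
  by apply/esym/(max_cyclic_inj maxC) => //; rewrite defC cycle_subG.
case/P4_e=> a [b [c [d [[ab bc cd] [ac bd ad]]]]].
have edge x y : e x y ->
    exists2 M : {group gT}, max_cyclic G M & (sgval x \in M) && (sgval y \in M).
  by apply: cyclic_pair_max; apply: subgP.
have same_max (M : {group gT}) (x y : [subg G]) :
    max_cyclic G M -> ~~ e x y -> sgval x \in M -> sgval y \in M -> False.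
  case/max_cyclicP=> _ cM _ /negP n_exy Mx My; case: n_exy.
  exact: cyclic_pair My.
have [[B maxB /andP[Ba Bb]] [A maxA /andP[Ab Ac]]] := (edge _ _ ab, edge _ _ bc).
have [C maxC /andP[Cc Cd]] := edge _ _ cd.
have C'b Cb := same_max C b d maxC bd Cb Cd.
have B'c := same_max B a c maxB ac Ba.
have [] := chain A B C maxA maxB maxC.
- by move=> eqAB; apply: B'c; rewrite -eqAB.
- by move=> eqAC; apply: C'b; rewrite -eqAC.
- by move=> eqBC; apply: (same_max B a d) => //; rewrite eqBC.
- by move/subsetP/(_ (sgval b)); rewrite !inE Ab Bb => /(_ isT).
by move/subsetP/(_ (sgval c)); rewrite !inE Ac Cc => /(_ isT).
Qed.
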